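(* Let $R$ be a ring. Then the following statements are equivalent: (a) $R$ is a left uniserial ring. (b) $R$ is a local left cu-uniserial ring. (c) $R$ is a semilocal left cu-uniserial ring. (d) $R$ is a local left virtually uniserial ring.
   Context: All rings are associative with identity and all modules are unitary left modules. A ring is local if it has a unique maximal left ideal. $\mathrm{J}(R)$ is the Jacobson radical, and $R$ is semilocal if $R/\mathrm{J}(R)$ is a semisimple Artinian ring. For a module $K$, $\mathrm{Rad}(K)$ denotes the intersection of all maximal submodules of $K$ (equal to $K$ if there are none). A nonzero module is uniform if every nonzero submodule is essential. A left $R$-module $M$ is cyclic-uniform uniserial (cu-uniserial) if for every finitely generated submodule $0\neq K\subseteq M$, $K/\mathrm{Rad}(K)$ is cyclic and uniform. A module $M$ is virtually simple if $M\neq 0$ and $N\cong M$ for every nonzero submodule $N$ of $M$; $M$ is virtually uniserial if for every finitely generated submodule $0\neq K\subseteq M$, $K/\mathrm{Rad}(K)$ is virtually simple. A module is uniserial if its submodules are linearly ordered by inclusion. The ring $R$ is left uniserial (resp. left cu-uniserial, left virtually uniserial) if the left module ${}_RR$ is uniserial (resp. cu-uniserial, virtually uniserial). *)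

(* Defs.v *)
From HB Require Import structures.
From mathcomp Require Import all_boot all_order all_algebra.
From mathcomp Require Import generic_quotient ring_quotient boolp.

Set Implicit Arguments.
Unset Strict Implicit.
Unset Printing Implicit Defensive.

Import GRing.Theory.
Local Open Scope ring_scope.
Local Open Scope quotient_scope.

(* Rings are [pzRingType]s here so that the quotient of a ring by its Jacobson
   radical needs no nontriviality proof.  Left ideals of [R] are submodules of
   the regular left module [R^o].  Submodules are boolean predicates; in the
   presence of the axioms of [boolp] these are arbitrary subsets. *)

Section SubmoduleAsModule.
Variables (R : pzRingType) (V : lmodType R) (N : submodClosed V).

Definition submod : Type := {x : V | x \in N}.

HB.instance Definition _ := SubChoice.on submod.
HB.instance Definition _ := [SubChoice_isSubLmodule of submod by <:].

End SubmoduleAsModule.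

Section QuotientModule.
Variables (R : pzRingType) (V : lmodType R) (N : submodClosed V).

Lemma submod_zmod_closed : zmod_closed N.
Proof. exact: GRing.submod_closedB (submodClosedP N). Qed.

(* [submodClosed] also covers semimodules and does not record closure under
   opposite, which the quotient construction requires. *)
Definition submod_zmodClosed : zmodClosed V :=
  HB.pack_for (zmodClosed V) (N : {pred V})
    (GRing.isZmodClosed.Build V (N : {pred V}) submod_zmod_closed).

Definition quotmod : Type := Quotient.quot submod_zmodClosed.

HB.instance Definition _ := GRing.Zmodule.on quotmod.

Definition qclass (x : V) : quotmod := \pi_(Quotient.quot submod_zmodClosed) x.
Definition qrepr (x : quotmod) : V := repr x.

Lemma qreprK : cancel qrepr qclass.
Proof. exact: reprK. Qed.

Lemma eq_qclass (x y : V) : (qclass x = qclass y) <-> (x - y \in N).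
Proof.
rewrite -[x - y \in N]/(x - y \in submod_zmodClosed) Quotient.idealrBE.
by split=> [/eqP|/eqP].
Qed.

Lemma qclass_is_zmod_morphism : zmod_morphism qclass.
Proof. exact: (@raddfB _ _ \pi_(Quotient.quot submod_zmodClosed)). Qed.

HB.instance Definition _ :=
  GRing.isZmodMorphism.Build V quotmod qclass qclass_is_zmod_morphism.

Lemma qclassD : {morph qclass : x y / x + y}.
Proof. exact: raddfD. Qed.

Definition qscale (a : R) (x : quotmod) : quotmod := qclass (a *: qrepr x).

Lemma qscale_class a x : qscale a (qclass x) = qclass (a *: x).
Proof.
apply/eq_qclass; rewrite -scalerBr; apply: rpredZ.
by apply/eq_qclass; rewrite qreprK.
Qed.

Lemma qscalerA a b v : qscale a (qscale b v) = qscale (a * b) v.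
Proof. by rewrite -[v]qreprK !qscale_class scalerA. Qed.

Lemma qscale1r : left_id 1 qscale.
Proof. by move=> v; rewrite -[v]qreprK qscale_class scale1r. Qed.

Lemma qscalerDr : right_distributive qscale +%R.
Proof.
move=> a u v; rewrite -[u]qreprK -[v]qreprK !qscale_class.
by rewrite -!qclassD qscale_class scalerDr.
Qed.

Lemma qscalerDl v : {morph qscale^~ v : a b / a + b}.
Proof.
by move=> a b; rewrite /= -[v]qreprK !qscale_class scalerDl qclassD.
Qed.

HB.instance Definition _ := GRing.Zmodule_isLmodule.Build R quotmod
  qscalerA qscale1r qscalerDr qscalerDl.

Lemma qclass_is_scalable : scalable qclass.
Proof. by move=> a x; rewrite -qscale_class. Qed.

HB.instance Definition _ :=
  GRing.isScalable.Build R V quotmod *:%R qclass qclass_is_scalable.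

End QuotientModule.

Section ModuleNotions.
Variables (R : pzRingType) (V : lmodType R).

Definition nonzero_mod : Prop := exists x : V, x != 0.

Definition nonzero_submod (N : submodClosed V) : Prop :=
  exists2 x : V, x \in N & x != 0.

Definition finitely_generated : Prop :=
  exists s : seq V, forall x : V,
    exists c : 'I_(size s) -> R, x = \sum_(i < size s) c i *: s`_i.

Definition cyclic_mod : Prop := exists m : V, forall x, exists a : R, x = a *: m.

Definition maximal_submod (N : submodClosed V) : Prop :=
  (exists x, x \notin N) /\
  (forall L : submodClosed V, {subset N <= L} ->
     {subset L <= N} \/ (forall x, x \in L)).

Definition simple_mod : Prop :=
  nonzero_mod /\
  (forall L : submodClosed V, (forall x, x \in L -> x = 0) \/ (forall x, x \in L)).

Definition essential (N : submodClosed V) : Prop :=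
  forall L : submodClosed V, nonzero_submod L ->
    exists x, [/\ x \in N, x \in L & x != 0].

Definition uniform_mod : Prop :=
  nonzero_mod /\ (forall N : submodClosed V, nonzero_submod N -> essential N).

Definition uniserial_mod : Prop :=
  forall N L : submodClosed V, {subset N <= L} \/ {subset L <= N}.

Definition artinian_mod : Prop :=
  forall N : nat -> submodClosed V, (forall n, {subset N n.+1 <= N n}) ->
    exists n, forall m, (n <= m)%N -> N m =i N n.

(* If [V] has no maximal submodule, [rad_pred] is the whole of [V]. *)
Definition rad_pred : {pred V} :=
  fun x => `[< forall N : submodClosed V, maximal_submod N -> x \in N >].

Lemma rad_subsemimod_closed : GRing.subsemimod_closed rad_pred.
Proof.
split; first split.
- by apply/asboolP=> N _; exact: rpred0.
- move=> x y /asboolP xN /asboolP yN; apply/asboolP=> N mN.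
  by rewrite rpredD ?xN ?yN.
- by move=> a x /asboolP xN; apply/asboolP=> N mN; rewrite rpredZ ?xN.
Qed.

HB.instance Definition _ :=
  GRing.isSubmodClosed.Build R V rad_pred rad_subsemimod_closed.

Definition Rad : submodClosed V := rad_pred.

End ModuleNotions.

Arguments nonzero_mod {R} V.
Arguments finitely_generated {R} V.
Arguments cyclic_mod {R} V.
Arguments simple_mod {R} V.
Arguments uniform_mod {R} V.
Arguments uniserial_mod {R} V.
Arguments artinian_mod {R} V.
Arguments Rad {R} V.

Definition isomorphic_mod (R : pzRingType) (U V : lmodType R) : Prop :=
  exists f : {linear U -> V}, bijective f.

Definition virtually_simple (R : pzRingType) (V : lmodType R) : Prop :=
  nonzero_mod V /\
  (forall N : submodClosed V, nonzero_submod N -> isomorphic_mod (submod N) V).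

(* [V] is the sum of its simple submodules. *)
Definition semisimple_mod (R : pzRingType) (V : lmodType R) : Prop :=
  forall x : V, exists n (S : 'I_n -> submodClosed V) (y : 'I_n -> V),
    (forall i, simple_mod (submod (S i)) /\ y i \in S i) /\ x = \sum_i y i.

Definition cu_uniserial (R : pzRingType) (V : lmodType R) : Prop :=
  forall K : submodClosed V, nonzero_submod K -> finitely_generated (submod K) ->
    cyclic_mod (quotmod (Rad (submod K))) /\
    uniform_mod (quotmod (Rad (submod K))).

Definition virtually_uniserial (R : pzRingType) (V : lmodType R) : Prop :=
  forall K : submodClosed V, nonzero_submod K -> finitely_generated (submod K) ->
    virtually_simple (quotmod (Rad (submod K))).

Definition jacobson (R : pzRingType) : submodClosed R^o := Rad R^o.

(* The ring [R / J(R)].  That [J(R)], an intersection of maximal left ideals, is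
   also a right ideal follows because [(N : b) = {y | y * b \in N}] is a maximal
   left ideal for every maximal left ideal [N] and [b] outside [N]. *)
Section JacobsonQuotient.
Variable R : pzRingType.
Local Notation J := (jacobson R).

Section ColonIdeal.
Variables (N : submodClosed R^o) (b : R).

Definition colon_pred : {pred R^o} := fun y : R => (y * b : R^o) \in N.

Lemma colon_subsemimod_closed : GRing.subsemimod_closed colon_pred.
Proof.
split; first split.
- by rewrite unfold_in /= mul0r (rpred0 N).
- by move=> x y xN yN; rewrite unfold_in /= mulrDl (rpredD (S := N)).
- by move=> a x xN; rewrite unfold_in /= -mulrA (@rpredZ _ _ N a).
Qed.

HB.instance Definition _ :=
  GRing.isSubmodClosed.Build R R^o colon_pred colon_subsemimod_closed.

End ColonIdeal.

(* The left ideal [L * b + N]. *)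
Section AddMul.
Variables (L : submodClosed R^o) (N : submodClosed R^o) (b : R).

Definition addmul_pred : {pred R^o} :=
  fun z : R => `[< exists2 y : R^o, y \in L & (z - y * b : R^o) \in N >].

Lemma addmul_subsemimod_closed : GRing.subsemimod_closed addmul_pred.
Proof.
split; first split.
- by apply/asboolP; exists 0; rewrite ?rpred0 // mul0r subr0 (rpred0 N).
- move=> x y /asboolP[u uL uN] /asboolP[v vL vN]; apply/asboolP.
  exists (u + v); first by rewrite rpredD.
  by rewrite mulrDl opprD addrACA (rpredD (S := N)).
- move=> a x /asboolP[u uL uN]; apply/asboolP.
  exists (a *: u); first by rewrite rpredZ.
  by rewrite -mulrA -[a *: x]/(a * x) -mulrBr (@rpredZ _ _ N a).
Qed.

HB.instance Definition _ :=
  GRing.isSubmodClosed.Build R R^o addmul_pred addmul_subsemimod_closed.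

End AddMul.

Lemma colon_maximal (N : submodClosed R^o) (b : R) :
  maximal_submod N -> b \notin (N : {pred R^o}) ->
  maximal_submod (colon_pred N b : submodClosed R^o).
Proof.
move=> [_ Nmax] bN; split; first by exists 1; rewrite unfold_in /= mul1r.
move=> L NL.
have [x xN|LN|LT] := Nmax (addmul_pred L N b : submodClosed R^o).
- by apply/asboolP; exists 0; rewrite ?rpred0 // mul0r subr0.
- left=> y yL; rewrite unfold_in /=; apply: LN; apply/asboolP.
  by exists y; rewrite // subrr (rpred0 N).
- right=> x; have /asboolP[y yL xyN] := LT (x * b).
  have : x - y \in L by apply: NL; rewrite unfold_in /= mulrBl.
  by move=> /(rpredD yL); rewrite addrCA subrr addr0.
Qed.

Lemma jacobsonMr (a b : R) :
  a \in (J : {pred R^o}) -> a * b \in (J : {pred R^o}).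
Proof.
move=> /asboolP aJ; apply/asboolP=> N Nmax.
have [bN|bN] := boolP (b \in (N : {pred R^o})).
  exact: (@rpredZ _ _ N a b).
exact: (aJ _ (colon_maximal Nmax bN)).
Qed.

Lemma jacobsonMl (a b : R) :
  b \in (J : {pred R^o}) -> a * b \in (J : {pred R^o}).
Proof. exact: (@rpredZ _ _ J a b). Qed.

Definition jacobson_quot : Type := quotmod J.

HB.instance Definition _ := GRing.Zmodule.on jacobson_quot.

Definition jq_class (x : R) : jacobson_quot := qclass J x.
Definition jq_repr (x : jacobson_quot) : R := qrepr x.
Definition jq_one : jacobson_quot := jq_class 1.
Definition jq_mul (x y : jacobson_quot) : jacobson_quot :=
  jq_class (jq_repr x * jq_repr y).

Lemma jq_reprK : cancel jq_repr jq_class.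
Proof. exact: qreprK. Qed.

Lemma jq_classD (x y : R) : jq_class (x + y) = jq_class x + jq_class y.
Proof. exact: qclassD. Qed.

Lemma jq_mul_class (x y : R) :
  jq_mul (jq_class x) (jq_class y) = jq_class (x * y).
Proof.
have repr_sub (z : R) : jq_repr (jq_class z) - z \in (J : {pred R^o}).
  by apply/(eq_qclass J); exact: jq_reprK.
apply/(eq_qclass J).
set x' : R := jq_repr (jq_class x); set y' : R := jq_repr (jq_class y).
have -> : x' * y' - x * y = x' * (y' - y) + (x' - x) * y :> R.
  by rewrite mulrBr mulrBl addrA subrK.
by apply: (rpredD (S := J));
  [apply: jacobsonMl; exact: repr_sub|apply: jacobsonMr; exact: repr_sub].
Qed.

Lemma jq_mulA : associative jq_mul.
Proof.
by move=> x y z; rewrite -[x]jq_reprK -[y]jq_reprK -[z]jq_reprK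
  !jq_mul_class mulrA.
Qed.

Lemma jq_mul1r : left_id jq_one jq_mul.
Proof. by move=> x; rewrite -[x]jq_reprK jq_mul_class mul1r. Qed.

Lemma jq_mulr1 : right_id jq_one jq_mul.
Proof. by move=> x; rewrite -[x]jq_reprK jq_mul_class mulr1. Qed.

Lemma jq_mulDl : left_distributive jq_mul +%R.
Proof.
by move=> x y z; rewrite -[x]jq_reprK -[y]jq_reprK -[z]jq_reprK
  -jq_classD !jq_mul_class mulrDl jq_classD.
Qed.

Lemma jq_mulDr : right_distributive jq_mul +%R.
Proof.
by move=> x y z; rewrite -[x]jq_reprK -[y]jq_reprK -[z]jq_reprK
  -jq_classD !jq_mul_class mulrDr jq_classD.
Qed.

HB.instance Definition _ := GRing.Zmodule_isPzRing.Build jacobson_quot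
  jq_mulA jq_mul1r jq_mulr1 jq_mulDl jq_mulDr.

End JacobsonQuotient.

Section RingNotions.
Variable R : pzRingType.

Definition local_ring : Prop :=
  exists M : submodClosed R^o, maximal_submod M /\
    (forall M' : submodClosed R^o, maximal_submod M' -> M' =i M).

Definition semisimple_artinian : Prop := semisimple_mod R^o /\ artinian_mod R^o.

Definition left_uniserial : Prop := uniserial_mod R^o.
Definition left_cu_uniserial : Prop := cu_uniserial R^o.
Definition left_virtually_uniserial : Prop := virtually_uniserial R^o.

End RingNotions.

Definition semilocal_ring (R : pzRingType) : Prop :=
  semisimple_artinian (jacobson_quot R).

(* Main.v *)
Require Import Defs.
From HB Require Import structures.
From mathcomp Require Import all_boot all_algebra.
From mathcomp Require Import boolp classical_sets.

Set Implicit Arguments.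
Unset Strict Implicit.
Unset Printing Implicit Defensive.

(** Call V/Rad(V) the top of a module V.  The four conditions are all about the
    tops of the nonzero finitely generated left ideals K, and they meet in the
    condition that R is local and every such top is simple.

    Over a local ring, cyclic nonzero tops are automatically simple
    ([local_top_simple]).  Indeed J(R) sends V into Rad(V), because the radical
    is preserved by every linear map ([Rad_map]), in particular by a |-> a v
    from R to V; so a cyclic top is a quotient of R/J(R), which is simple when R
    is local.  A simple module is cyclic, uniform and virtually simple, and a
    virtually simple module is cyclic, being isomorphic to a cyclic submodule.
    Hence left cu-uniserial and left virtually uniserial both mean, over a local
    ring, that the tops are simple.

    A semilocal left cu-uniserial ring is local: the top R/J(R) of R itself is
    semisimple and uniform, and a semisimple module has no proper essential
    submodule, so R/J(R) is simple and J(R) is a maximal left ideal, hence the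
    only one ([semilocal_uniform_top_local]).

    If R is left uniserial, a nonzero finitely generated left ideal K is cyclic
    with some generator m, and the proper submodules of K form a chain whose
    union omits m; this union is the unique maximal submodule, so the top of K
    is simple ([uniserial_cyclic_top]).  The case K = R shows that R is local.

    Conversely, if N and L are incomparable left ideals, pick x in N outside L
    and y in L outside N.  By Zorn's lemma K = Rx + Ry has a maximal submodule
    containing x and not y, and one containing y and not x.  Two distinct
    maximal submodules prevent Rad(K) from being maximal, so the top of K is not
    simple ([maximal_Rad_comparable], [uniserial_of_tops]). *)

Import GRing.Theory.
Local Open Scope ring_scope.

(** * Submodules given by propositions *)

Section SubmodOf.
Variables (R : pzRingType) (V : lmodType R) (P : V -> Prop).

(** Closure under [a *: x + y] covers sums ([a = 1]) and multiples ([y = 0])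
    at once. *)
Definition submodule_prop :=
  P 0 /\ (forall a x y, P x -> P y -> P (a *: x + y)).

Hypothesis PP : submodule_prop.

Definition pred_of_prop : {pred V} := fun x => `[< P x >].

Lemma pred_of_prop_closed : GRing.subsemimod_closed pred_of_prop.
Proof.
case: PP => P0 PL; split; first split; first exact/asboolP.
- move=> x y /asboolP xP /asboolP yP; apply/asboolP.
  by rewrite -[x]scale1r; exact: PL.
- move=> a x /asboolP xP; apply/asboolP.
  by rewrite -[_ *: _]addr0; exact: PL.
Qed.

Definition submodOf : submodClosed V :=
  HB.pack_for (submodClosed V) pred_of_prop
    (GRing.isSubmodClosed.Build R V pred_of_prop pred_of_prop_closed).

Lemma submodOfP x : reflect (P x) (x \in submodOf).
Proof. exact: asboolP. Qed.

End SubmodOf.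

Section Constructions.
Variables (R : pzRingType) (V : lmodType R).

Lemma submodP (N : submodClosed V) : submodule_prop (fun x => x \in N).
Proof. by split=> [|a x y xN yN]; rewrite ?rpred0 // rpredD ?rpredZ. Qed.

Lemma full_submodule : submodule_prop (fun _ : V => True).
Proof. by []. Qed.

Definition fullmod : submodClosed V := submodOf full_submodule.

Lemma cyclic_submodule (v : V) : submodule_prop (fun x => exists a, x = a *: v).
Proof.
split=> [|a _ _ [b ->] [c ->]]; first by exists 0; rewrite scale0r.
by exists (a * b + c); rewrite scalerDl scalerA.
Qed.

Definition cyc (v : V) : submodClosed V := submodOf (cyclic_submodule v).

Lemma cycP (v x : V) : reflect (exists a, x = a *: v) (x \in cyc v).
Proof. exact: submodOfP. Qed.

Lemma mem_cyc (v : V) : v \in cyc v.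
Proof. by apply/cycP; exists 1; rewrite scale1r. Qed.

Lemma cyc_sub (N : submodClosed V) v : v \in N -> {subset cyc v <= N}.
Proof. by move=> vN _ /cycP[a ->]; rewrite rpredZ. Qed.

Lemma add_submodule (N L : submodClosed V) :
  submodule_prop (fun x => exists2 y, y \in N & x - y \in L).
Proof.
split=> [|a x y [u uN xuL] [v vN yvL]].
  by exists 0; rewrite ?subr0 rpred0.
exists (a *: u + v); first by rewrite rpredD ?rpredZ.
by rewrite opprD addrACA -scalerBr rpredD ?rpredZ.
Qed.

Definition addmod (N L : submodClosed V) : submodClosed V :=
  submodOf (add_submodule N L).

Lemma addmodP (N L : submodClosed V) x :
  reflect (exists2 y, y \in N & x - y \in L) (x \in addmod N L).
Proof. exact: submodOfP. Qed.

Lemma addmodl (N L : submodClosed V) : {subset N <= addmod N L}.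
Proof. by move=> x xN; apply/addmodP; exists x; rewrite // subrr rpred0. Qed.

Lemma addmodr (N L : submodClosed V) : {subset L <= addmod N L}.
Proof. by move=> x xL; apply/addmodP; exists 0; rewrite ?rpred0 ?subr0. Qed.

End Constructions.

Section LinearMaps.
Variables (R : pzRingType) (U V : lmodType R) (f : {linear U -> V}).

Lemma image_submodule (N : submodClosed U) :
  submodule_prop (fun y => exists2 x, x \in N & y = f x).
Proof.
split=> [|a _ _ [x xN ->] [y yN ->]].
  by exists 0; rewrite ?rpred0 ?linear0.
by exists (a *: x + y); rewrite ?linearP // rpredD ?rpredZ.
Qed.

Definition immod (N : submodClosed U) : submodClosed V :=
  submodOf (image_submodule N).

Lemma immodP (N : submodClosed U) y :
  reflect (exists2 x, x \in N & y = f x) (y \in immod N).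
Proof. exact: submodOfP. Qed.

Lemma preim_submodule (N : submodClosed V) :
  submodule_prop (fun x => f x \in N).
Proof.
by split=> [|a x y xN yN]; rewrite ?linear0 ?rpred0 // linearP rpredD ?rpredZ.
Qed.

Definition premod (N : submodClosed V) : submodClosed U :=
  submodOf (preim_submodule N).

Lemma premodP (N : submodClosed V) x : reflect (f x \in N) (x \in premod N).
Proof. exact: submodOfP. Qed.

End LinearMaps.

(** * Maximal submodules and the radical *)

Section MaximalElementwise.
Variables (R : pzRingType) (V : lmodType R).

(** The elementwise form says that every nonzero class generates the quotient
    by [N]; it mentions no other submodule, which makes it easy to move along
    linear maps and between R and R/J(R). *)
Lemma maximalP (N : submodClosed V) :
  maximal_submod N <->
  (exists x, x \notin N) /\
  (forall x y, x \notin N -> exists a, y - a *: x \in N).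
Proof.
split=> -[Nproper Nmax]; split=> //.
- move=> x y xN.
  have [|sub|full] := Nmax (addmod (cyc x) N); first exact: addmodr.
    by case/negP: xN; apply: sub; apply: addmodl; apply: mem_cyc.
  by have /addmodP[_ /cycP[a ->] yN] := full y; exists a.
- move=> L NL; have [sub|/existsNP[x /not_implyP[xL /negP xN]]] :=
    pselect {subset L <= N}; first by left.
  right=> y; have [a yaN] := Nmax _ y xN.
  by rewrite -(subrK (a *: x) y) rpredD ?rpredZ // NL.
Qed.

Lemma maximal_eq (N L : submodClosed V) :
  maximal_submod N -> (exists x, x \notin L) -> {subset N <= L} -> N =i L.
Proof.
move=> [_ Nmax] [z zL] NL x; apply/idP/idP; first exact: NL.
by have [|full] := Nmax _ NL; [apply | case/negP: zL].
Qed.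

Lemma maximal_submod_ext (N L : submodClosed V) :
  N =i L -> maximal_submod N -> maximal_submod L.
Proof.
move=> NL /maximalP[[x xN] Nmax]; apply/maximalP; split.
  by exists x; rewrite -NL.
by move=> u v; rewrite -NL => /Nmax-/(_ v)[a aN]; exists a; rewrite -NL.
Qed.

Lemma RadP x :
  reflect (forall N : submodClosed V, maximal_submod N -> x \in N)
          (x \in Rad V).
Proof. exact: asboolP. Qed.

Lemma Rad_sub (N : submodClosed V) :
  maximal_submod N -> {subset Rad V <= N}.
Proof. by move=> Nmax x /RadP; apply. Qed.

(** When [y] and [N] span [V], a submodule above [N] is proper as soon as it
    avoids [y]; a submodule that is maximal among those avoiding [y] is
    therefore maximal outright. *)
Lemma exists_maximal_above (N : submodClosed V) y :
    y \notin N -> (forall x, x \in addmod (cyc y) N) ->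
  exists P : submodClosed V,
    [/\ maximal_submod P, {subset N <= P} & y \notin P].
Proof.
move=> yN spanV.
pose good (X : set V) :=
  [/\ submodule_prop X, (forall x, x \in N -> X x) & ~ X y].
(* The guard lets the union of the empty chain, which is empty, qualify. *)
pose goodn (X : set V) := (exists x, X x) -> good X.
have [F Fgood Ftot|A [Agood Amax]] := @Zorn_bigcup V goodn.
  move=> [z [X0 FX0 X0z]].
  have good_of X x : F X -> X x -> good X.
    by move=> FX Xx; apply: (Fgood X FX); exists x.
  have [[X00 _] NX0 _] := good_of _ _ FX0 X0z.
  split.
  - split; first by exists X0.
    move=> a u v [X FX Xu] [Y FY Yv].
    have [[_ XL] _ _] := good_of _ _ FX Xu.
    have [[_ YL] _ _] := good_of _ _ FY Yv.
    have [XY|YX] := Ftot _ _ FX FY.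
      by exists Y => //; apply: YL => //; apply: XY.
    by exists X => //; apply: XL => //; apply: YX.
  - by move=> x xN; exists X0 => //; apply: NX0.
  - by move=> [X FX Xy]; have [_ _] := good_of _ _ FX Xy.
have goodN : good (fun x => x \in N).
  by split; [exact: submodP | by [] | exact/negP].
have A0 : exists x, A x.
  apply: contrapT => nA; apply: (Amax (fun x => x \in N)) => //.
  split=> [x Ax|NA]; first by case: nA; exists x.
  by apply: nA; exists 0; apply: NA; exact: rpred0.
have [Asub NA Ay] := Agood A0.
have yP : y \notin submodOf Asub by apply/negP => /submodOfP.
exists (submodOf Asub); split=> //; last by move=> x xN; apply/submodOfP/NA.
split; first by exists y.
move=> L AL.
have [yL|yL] := boolP (y \in L).
  right=> x; have /addmodP[_ /cycP[a ->] xaN] := spanV x.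
  rewrite -(subrK (a *: y) x) rpredD ?rpredZ //.
  by apply: AL; apply/submodOfP/NA.
left=> x xL; apply/submodOfP; apply: contrapT => nAx.
apply: (Amax (fun x => x \in L)).
  split=> [z Az|LA]; last exact/nAx/LA.
  by apply: AL; apply/submodOfP.
move=> _; split; [exact: submodP | | exact/negP].
by move=> z zN; apply: AL; apply/submodOfP/NA.
Qed.

End MaximalElementwise.

Section RadFunctorial.
Variables (R : pzRingType) (U V : lmodType R) (f : {linear U -> V}).

(** [f] embeds the quotient by the preimage of [N] into the simple quotient by
    [N]; the image is nonzero because of [f x], hence everything. *)
Lemma maximal_premod (N : submodClosed V) x :
  maximal_submod N -> f x \notin N -> maximal_submod (premod f N).
Proof.
move=> /maximalP[_ Nmax] xN; apply/maximalP; split.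
  by exists x; apply: contra xN => /premodP.
move=> u v uN; have {}uN : f u \notin N by apply: contra uN => /premodP.
have [a aN] := Nmax _ (f v) uN; exists a; apply/premodP.
by rewrite linearB linearZ.
Qed.

(** The preimage of a maximal submodule is either maximal or the whole
    module, and in both cases it contains the radical. *)
Lemma Rad_map x : x \in Rad U -> f x \in Rad V.
Proof.
move=> /RadP xRad; apply/RadP => N Nmax.
apply: contraT => xN.
by have /premodP := xRad _ (maximal_premod Nmax xN); rewrite (negPf xN).
Qed.

End RadFunctorial.

Section ScaleMap.
Variables (R : pzRingType) (V : lmodType R) (v : V).

(** A separate name for [a |-> a *: v], so that it can carry the structure of
    a linear map on the regular module. *)
Definition scale_at (a : R^o) : V := (a : R) *: v.

Lemma scale_at_linear : linear scale_at.
Proof. by move=> a x y; rewrite /scale_at scalerDl scalerA. Qed.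

HB.instance Definition _ :=
  GRing.isLinear.Build R R^o V *:%R scale_at scale_at_linear.

Lemma jacobson_scale (a : R) :
  a \in (jacobson R : {pred R^o}) -> a *: v \in Rad V.
Proof. exact: (Rad_map scale_at). Qed.

End ScaleMap.

(** * Simple, uniform and semisimple modules *)

Section Elementwise.
Variables (R : pzRingType) (V : lmodType R).

(** Being free of submodules, this criterion and the next one transfer directly
    between R/J(R) as an R-module and as a module over itself. *)
Lemma simpleP :
  simple_mod V <->
  nonzero_mod V /\ (forall x y : V, x != 0 -> exists a, y = a *: x).
Proof.
split=> -[V0 simV]; split=> //.
  move=> x y x0; have [zero|full] := simV (cyc x); last exact/cycP/full.
  by move: x0; rewrite (zero x) ?mem_cyc ?eqxx.
move=> L; have [[x xL x0]|noL] := pselect (nonzero_submod L).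
  by right=> y; have [a ->] := simV x y x0; rewrite rpredZ.
left=> x xL; apply/eqP; apply: contraPT isT => x0 _.
by apply: noL; exists x.
Qed.

Lemma uniformP :
  uniform_mod V <->
  nonzero_mod V /\
  (forall x y : V, x != 0 -> y != 0 ->
     exists a b, a *: x = b *: y /\ a *: x != 0).
Proof.
split=> -[V0 uniV]; split=> //.
  move=> x y x0 y0.
  have cyc0 (z : V) : z != 0 -> nonzero_submod (cyc z).
    by exists z; rewrite ?mem_cyc.
  have [_ [/cycP[a ->] /cycP[b ab] ax0]] :=
    uniV _ (cyc0 _ x0) _ (cyc0 _ y0).
  by exists a, b.
move=> N [x xN x0] L [y yL y0]; have [a [b [ab ax0]]] := uniV _ _ x0 y0.
by exists (a *: x); rewrite {2}ab !rpredZ.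
Qed.

Lemma simple_cyclic : simple_mod V -> cyclic_mod V.
Proof.
by move=> /simpleP[[x x0] simV]; exists x => y; apply: simV.
Qed.

Lemma simple_uniform : simple_mod V -> uniform_mod V.
Proof.
move=> /simpleP[V0 simV]; apply/uniformP; split=> // x y x0 y0.
by have [b xb] := simV y x y0; exists 1, b; rewrite scale1r.
Qed.

Lemma simple_virtually_simple : simple_mod V -> virtually_simple V.
Proof.
move=> simV; split=> [|N [x xN x0]]; first by case: simV.
have full : forall y, y \in N.
  by move=> y; have /simpleP[_ /(_ x y x0)[a ->]] := simV; rewrite rpredZ.
exists (val : {linear submod N -> V}).
by exists (fun y => Sub y (full y)) => y; [apply: val_inj|]; rewrite /= ?SubK.
Qed.

(** The module is isomorphic to any of its nonzero cyclic submodules. *)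
Lemma virtually_simple_cyclic : virtually_simple V -> cyclic_mod V.
Proof.
move=> [[x x0] isoV].
have [|f [g fK gK]] := isoV (cyc x); first by exists x; rewrite ?mem_cyc.
exists (f (Sub x (mem_cyc x))) => y.
have /cycP[a ga] := valP (g y); exists a; rewrite -linearZ -[LHS]gK.
by congr (f _); apply: val_inj.
Qed.

End Elementwise.

Section Semisimple.
Variables (R : pzRingType) (V : lmodType R).

Lemma simple_fullmod : simple_mod V -> simple_mod (submod (fullmod V)).
Proof.
move=> /simpleP[[x x0] simV]; apply/simpleP; split.
  have xF : x \in fullmod V by apply/submodOfP.
  by exists (Sub x xF).
move=> u v u0; have [a va] := simV (val u) (val v) u0.
by exists a; apply: val_inj.
Qed.

(** An essential submodule meets every simple submodule, so it contains every
    simple submodule, and these span the module. *)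
Lemma essential_semisimple_full (N : submodClosed V) :
  semisimple_mod V -> essential N -> forall x, x \in N.
Proof.
move=> ssV essN x; have [n [S [y [Sy ->]]]] := ssV x.
apply: rpred_sum => i _; have [/simpleP[_ simS] yS] := Sy i.
have [->|y0] := eqVneq (y i) 0; first exact: rpred0.
have [|z [zN zS z0]] := essN (S i); first by exists (y i).
have [|a /(congr1 val) /= ->] := simS (Sub z zS) (Sub (y i) yS).
  exact: z0.
by rewrite rpredZ.
Qed.

Lemma uniform_semisimple_simple :
  uniform_mod V -> semisimple_mod V -> simple_mod V.
Proof.
move=> [V0 uniV] ssV; apply/simpleP; split=> // x y x0; apply/cycP.
apply: essential_semisimple_full => //; apply: uniV.
by exists x; rewrite ?mem_cyc.
Qed.

Lemma simple_semisimple_artinian :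
  simple_mod V -> semisimple_mod V /\ artinian_mod V.
Proof.
move=> simV; split=> [x|N Ndec].
  exists 1, (fun=> fullmod V), (fun=> x); split; last by rewrite big_ord1.
  by move=> _; split; [exact: simple_fullmod | exact/submodOfP].
have dec n m : (n <= m)%N -> {subset N m <= N n}.
  by move=> /subnK <-; elim: (m - n)%N => // k IHk x /Ndec /IHk.
have [[n zero]|noz] := pselect (exists n, forall x, x \in N n -> x = 0).
  exists n => m nm x; apply/idP/idP; first exact: dec.
  by move=> /zero ->; rewrite rpred0.
exists 0 => m _ x.
have full k : forall z, z \in N k.
  by have [zero|//] := simV.2 (N k); case: noz; exists k.
by rewrite !full.
Qed.

End Semisimple.

(** * Tops of modules over local rings *)

Section Quotients.
Variables (R : pzRingType) (V : lmodType R) (N : submodClosed V).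

Lemma qclass_eq0 (x : V) : (qclass N x == 0) = (x \in N).
Proof.
rewrite -(raddf0 (qclass N)); apply/eqP/idP => [/eq_qclass|xN].
  by rewrite subr0.
by apply/eq_qclass; rewrite subr0.
Qed.

Lemma simple_quotP : simple_mod (quotmod N) <-> maximal_submod N.
Proof.
split.
  move=> /simpleP[[q q0] simQ]; apply/maximalP; split.
    by exists (qrepr q); rewrite -qclass_eq0 qreprK.
  move=> x y xN; have [|a ya] := simQ (qclass N x) (qclass N y).
    by rewrite qclass_eq0.
  by exists a; apply/eq_qclass; rewrite ya linearZ.
move=> /maximalP[[z zN] Nmax]; apply/simpleP; split.
  by exists (qclass N z); rewrite qclass_eq0.
move=> x y; rewrite -(qreprK x) -(qreprK y) qclass_eq0 => xN.
by have [a aN] := Nmax _ (qrepr y) xN; exists a;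
  rewrite -linearZ; apply/eq_qclass.
Qed.

End Quotients.

Section LocalRings.
Variable R : pzRingType.
Implicit Type V : lmodType R.

(** If there is a unique maximal left ideal then it is J(R); conversely J(R)
    lies in every maximal left ideal, and equals it when J(R) is maximal. *)
Lemma local_ringP : local_ring R <-> maximal_submod (jacobson R).
Proof.
split=> [[M [Mmax Muniq]]|Jmax].
  have JM : (jacobson R : {pred R^o}) =i M.
    move=> x; apply/idP/idP; first exact: Rad_sub.
    by move=> xM; apply/RadP => N /Muniq ->.
  by apply: maximal_submod_ext Mmax => x; rewrite JM.
exists (jacobson R); split=> // N Nmax x.
by rewrite (maximal_eq Jmax (proj1 Nmax) (Rad_sub Nmax)).
Qed.

(** The generator of the top is killed by J(R), so the top is a nonzero
    quotient of the simple module R/J(R). *)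
Lemma local_top_simple V :
    local_ring R -> cyclic_mod (quotmod (Rad V)) ->
    nonzero_mod (quotmod (Rad V)) ->
  simple_mod (quotmod (Rad V)).
Proof.
move=> /local_ringP/maximalP[_ Jmax] [m genm] Q0; apply/simpleP; split=> // x y.
have [r ->] := genm x; have [b ->] := genm y => rm0.
have Jm (a : R) : a \in (jacobson R : {pred R^o}) -> a *: m = 0.
  move=> aJ; apply/eqP; rewrite -(qreprK m) -linearZ qclass_eq0.
  exact: jacobson_scale.
have rJ : r \notin (jacobson R : {pred R^o}) by apply: contra rm0 => /Jm ->.
have [a /Jm] := Jmax r b rJ.
rewrite scalerBl => /eqP; rewrite subr_eq0 => /eqP ->.
by exists a; rewrite scalerA.
Qed.

Lemma jq_class_eq0 (x : R) :
  (jq_class x == 0 :> (jacobson_quot R)^o) = (x \in (jacobson R : {pred R^o})).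
Proof. exact: qclass_eq0. Qed.

(** R/J(R) is simple as an R-module, hence simple as a module over itself. *)
Lemma local_semilocal :
  local_ring R -> semilocal_ring R.
Proof.
move=> /local_ringP/maximalP[[x xJ] Jmax]; apply: simple_semisimple_artinian.
apply/simpleP; split.
  by exists (@jq_class R x); rewrite jq_class_eq0.
move=> u v u0; have uJ : jq_repr u \notin (jacobson R : {pred R^o}).
  by rewrite -jq_class_eq0 jq_reprK.
have [a aJ] := Jmax _ (jq_repr v) uJ; exists (@jq_class R a).
rewrite -(jq_reprK v) -[in RHS](jq_reprK u) [RHS]jq_mul_class.
exact/eq_qclass.
Qed.

End LocalRings.

Section Semilocal.
Variable R : pzRingType.
Local Notation J := (jacobson R : {pred R^o}).

(** The isomorphism from R onto R seen as an ideal of itself.  The conditions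
    on left ideals apply to the latter, whereas J(R) is the radical of the
    former. *)
Definition tofull (x : R^o) : submod (fullmod R^o) :=
  Sub x (introT (submodOfP (full_submodule R^o) x) I).

Lemma tofull_linear : linear tofull.
Proof. by move=> a x y; apply: val_inj. Qed.

HB.instance Definition _ :=
  GRing.isLinear.Build R R^o (submod (fullmod R^o)) *:%R tofull tofull_linear.

(** Both this map and its inverse are linear, so each preserves the radical. *)
Lemma Rad_tofull x : (tofull x \in Rad _) = (x \in J).
Proof.
apply/idP/idP; last exact: Rad_map.
exact: (Rad_map (val : {linear submod (fullmod R^o) -> R^o})).
Qed.

(** Uniformity is carried from the top of the ideal R to R/J(R) as a module over
    itself; there it combines with semisimplicity to give simplicity, which
    says that J(R) is maximal. *)
Lemma semilocal_uniform_top_local :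
    semilocal_ring R ->
    uniform_mod (quotmod (Rad (submod (fullmod R^o)))) ->
  local_ring R.
Proof.
move=> [ssW _] /uniformP[[q q0] uniQ].
set W := (jacobson_quot R)^o : lmodType _.
pose t x := qclass (Rad _) (tofull x).
have t0 x : (t x == 0) = (x \in J) by rewrite qclass_eq0 Rad_tofull.
have uniW : uniform_mod W.
  apply/uniformP; split.
    exists (@jq_class R (val (qrepr q))).
    rewrite jq_class_eq0 -t0; move: q0; rewrite -{1}(qreprK q).
    congr (~~ (qclass _ _ == 0)).
    exact: val_inj.
  move=> x y; rewrite -(jq_reprK x) -(jq_reprK y) !jq_class_eq0 -!t0 => x0 y0.
  have [a [b [ab ax0]]] := uniQ _ _ x0 y0.
  exists (@jq_class R a), (@jq_class R b).
  rewrite -!linearZ /= in ab ax0.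
  rewrite ![_ *: _]jq_mul_class; split; last by rewrite jq_class_eq0 -t0.
  apply/eqP; rewrite -subr_eq0 -raddfB jq_class_eq0 -t0.
  by rewrite /t !raddfB /= subr_eq0; apply/eqP.
have /simpleP[_ simW] := uniform_semisimple_simple uniW ssW.
have [[w w0] _] := uniW.
apply/local_ringP/maximalP; split.
  by exists (@jq_repr R w); rewrite -(@jq_class_eq0 R) jq_reprK.
move=> x y; rewrite -(@jq_class_eq0 R) => x0.
have [a ya] := simW _ (@jq_class R y) x0.
exists (@jq_repr R a); apply/eq_qclass; rewrite [LHS]ya.
by rewrite -{1}(jq_reprK a) [LHS]jq_mul_class.
Qed.

End Semilocal.

(** * Uniserial modules *)

Section Uniserial.
Variables (R : pzRingType) (V : lmodType R).

Lemma uniserial_submod (K : submodClosed V) :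
  uniserial_mod V -> uniserial_mod (submod K).
Proof.
pose i : {linear submod K -> V} := val.
move=> uniV N L; have [NL|LN] := uniV (immod i N) (immod i L);
  [left|right] => x xN.
  have /NL/immodP[y yL /val_inj -> //] : i x \in immod i N.
  by apply/immodP; exists x.
have /LN/immodP[y yL /val_inj -> //] : i x \in immod i L.
by apply/immodP; exists x.
Qed.

(** Among finitely many generators, one generates the largest cyclic
    submodule. *)
Lemma uniserial_fg_cyclic :
  uniserial_mod V -> finitely_generated V -> cyclic_mod V.
Proof.
move=> uniV [s gen_s].
have [m sm] : exists m, forall x, x \in s -> x \in cyc m.
  elim: {gen_s} s => [|x s [m sm]]; first by exists 0.
  have [xm|mx] := uniV (cyc x) (cyc m).
    by exists m => y; rewrite inE => /predU1P[->|/sm //]; apply/xm/mem_cyc.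
  exists x => y; rewrite inE => /predU1P[->|/sm/mx //]; exact: mem_cyc.
exists m => x; have [c ->] := gen_s x; apply/cycP.
by apply: rpred_sum => i _; rewrite rpredZ // sm ?mem_nth.
Qed.

(** A submodule is proper exactly when it omits the generator [m].  The union
    of all proper submodules is the set of [v] with [m] outside [R v]; it is a
    submodule because the cyclic submodules form a chain, and it is then the
    unique maximal submodule. *)
Lemma uniserial_cyclic_top :
  uniserial_mod V -> nonzero_mod V -> cyclic_mod V ->
  maximal_submod (Rad V).
Proof.
move=> uniV [x x0] [m gen_m].
have cyc_full (N : submodClosed V) : m \in N -> forall y, y \in N.
  by move=> mN y; have [a ->] := gen_m y; rewrite rpredZ.
have PP : submodule_prop (fun v => m \notin cyc v).
  split.
    apply: contra x0 => /cycP[a m0]; have [b ->] := gen_m x.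
    by rewrite m0 !scaler0.
  move=> a u v mu mv; apply/negP => muv.
  have [uv|vu] := uniV (cyc u) (cyc v).
    case/negP: mv; apply: (cyc_sub _ muv); rewrite rpredD ?mem_cyc //.
    by rewrite rpredZ // uv ?mem_cyc.
  case/negP: mu; apply: (cyc_sub _ muv); rewrite rpredD ?rpredZ ?mem_cyc //.
  by rewrite vu ?mem_cyc.
have proper_sub (L : submodClosed V) y :
    y \notin L -> {subset L <= submodOf PP}.
  move=> yL z zL; apply/submodOfP; apply: contra yL => mz.
  exact/cyc_full/(cyc_sub zL).
have Pproper : m \notin submodOf PP.
  by apply/negP => /submodOfP; rewrite mem_cyc.
have Pmax : maximal_submod (submodOf PP).
  split; first by exists m.
  move=> L _; have [|/existsNP[y /negP yL]] := pselect (forall y, y \in L).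
    by right.
  by left; apply: proper_sub yL.
apply: (maximal_submod_ext _ Pmax) => v; apply/idP/idP; last exact: Rad_sub.
move=> vP; apply/RadP => N Nmax; have [y yN] := proj1 Nmax.
by rewrite (maximal_eq Nmax _ (proper_sub _ _ yN)) //; exists m.
Qed.

(** If [R u] does not contain [v], a maximal submodule containing [u] and not
    [v] exists, and it has to be the radical when the radical is maximal; so
    [u] is in the radical.  If neither generator is a multiple of the other,
    both are in the radical, which is then not proper. *)
Lemma maximal_Rad_comparable (x y : V) :
    maximal_submod (Rad V) ->
    (forall z, z \in addmod (cyc x) (cyc y)) ->
  x \in cyc y \/ y \in cyc x.
Proof.
move=> Rmax spanV.
have gen_in_Rad u v : (forall z, z \in addmod (cyc v) (cyc u)) ->
    v \notin cyc u -> u \in Rad V.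
  move=> span vu; have [P [Pmax uP vP]] := exists_maximal_above vu span.
  by rewrite (maximal_eq Rmax (proj1 Pmax) (Rad_sub Pmax)) uP ?mem_cyc.
have [|xy] := boolP (x \in cyc y); first by left.
have [|yx] := boolP (y \in cyc x); first by right.
have yRad := gen_in_Rad _ _ spanV xy.
have xRad : x \in Rad V.
  apply: (gen_in_Rad _ y) yx => z; have /addmodP[u ux zuy] := spanV z.
  by apply/addmodP; exists (z - u); rewrite // subKr.
have [[z zRad] _] := Rmax; case/negP: zRad.
have /addmodP[u ux zuy] := spanV z.
by rewrite -(subrK u z) rpredD ?(cyc_sub yRad zuy) ?(cyc_sub xRad ux).
Qed.

End Uniserial.

(** Incomparable submodules would provide [x] and [y] that are not multiples of
    each other; the two-generated submodule [R x + R y] then contradicts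
    [maximal_Rad_comparable]. *)
Lemma uniserial_of_tops (R : pzRingType) (V : lmodType R) :
    (forall K : submodClosed V, nonzero_submod K ->
       finitely_generated (submod K) -> maximal_submod (Rad (submod K))) ->
  uniserial_mod V.
Proof.
move=> topmax N L; apply: contrapT => /not_orP[].
move=> /existsNP[x /not_implyP[xN xL]] /existsNP[y /not_implyP[yL yN]].
set K := addmod (cyc x) (cyc y).
have xK : x \in K by apply/addmodl/mem_cyc.
have yK : y \in K by apply/addmodr/mem_cyc.
pose x' : submod K := Sub x xK; pose y' : submod K := Sub y yK.
have comb (z : submod K) : exists a b, z = a *: x' + b *: y'.
  have /addmodP[_ /cycP[a ->] /cycP[b zab]] := valP z.
  by exists a, b; apply: val_inj; rewrite /= -zab addrC subrK.
have fgK : finitely_generated (submod K).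
  exists [:: x'; y'] => z; have [a [b ->]] := comb z.
  exists (fun i => if val i == 0 then a else b).
  by rewrite !big_ord_recl big_ord0 addr0.
have K0 : nonzero_submod K.
  by exists x => //; apply/eqP => x0; apply: xL; rewrite x0 rpred0.
have [z|/cycP[a /(congr1 val)/= xa]|/cycP[a /(congr1 val)/= ya]] :=
    maximal_Rad_comparable (x := x') (y := y') (topmax K K0 fgK).
- have [a [b ->]] := comb z; apply/addmodP; exists (a *: x').
    by apply/cycP; exists a.
  by apply/cycP; exists b; rewrite addrC addrA addNr add0r.
- by apply: xL; rewrite xa rpredZ.
- by apply: yN; rewrite ya rpredZ.
Qed.

Lemma uniserial_top_simple (R : pzRingType) (V : lmodType R)
    (K : submodClosed V) :
    uniserial_mod V -> nonzero_submod K -> finitely_generated (submod K) ->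
  simple_mod (quotmod (Rad (submod K))).
Proof.
move=> uniV [x xK x0] fgK; have uniK := uniserial_submod (K := K) uniV.
apply/simple_quotP/uniserial_cyclic_top => //.
  by exists (Sub x xK).
exact: uniserial_fg_cyclic.
Qed.

Theorem theorem2p6 (R : nzRingType) :
  [<-> left_uniserial R;
       local_ring R /\ left_cu_uniserial R;
       semilocal_ring R /\ left_cu_uniserial R;
       local_ring R /\ left_virtually_uniserial R].
Proof.
have R0 : nonzero_mod R^o by exists 1; exact: oner_neq0.
tfae.
- move=> uniR; split.
    apply/local_ringP/uniserial_cyclic_top => //.
    by exists 1 => x; exists x; rewrite [RHS]mulr1.
  move=> K K0 fgK; have simQ := uniserial_top_simple uniR K0 fgK.
  by split; [exact: simple_cyclic | exact: simple_uniform].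
- by move=> [locR cuR]; split=> //; exact: local_semilocal.
- move=> [slR cuR].
  have locR : local_ring R.
    apply: semilocal_uniform_top_local slR _; apply: (cuR _ _ _).2.
      by exists 1; [exact/submodOfP | exact: oner_neq0].
    exists [:: tofull (1 : R)] => x; exists (fun=> val x).
    by rewrite big_ord1; apply: val_inj; rewrite /= [RHS]mulr1.
  split=> // K K0 fgK; have [cycQ [Q0 _]] := cuR K K0 fgK.
  exact/simple_virtually_simple/local_top_simple.
- move=> [locR vuR]; apply: uniserial_of_tops => K K0 fgK.
  have vsQ := vuR K K0 fgK.
  apply/simple_quotP/local_top_simple => //; last by case: vsQ.
  exact: virtually_simple_cyclic.
Qed.
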